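(* Let $\omega>0$ and suppose that $K$ satisfies $$K(r)\le\Lambda\,\chi_{(-R,R)}(r)\qquad\text{for all }r\in\mathbb{R},$$ for some $\Lambda,R>0$. Assume that there exists a solution of $$\partial_t u(x,t)=c\,\partial_x^2u(x,t)+\int_{\mathbb{R}}\big(u(y,t)-\Theta\big)_+\,K(x-y)\,dy,\qquad x\in\mathbb{R},\ t\in\mathbb{R},$$ of the form $$u(x,t)=v(x+\omega t)+\Theta$$ for some $v:\mathbb{R}\to\mathbb{R}$, with $v(0)=0$ and $v'(0)=\kappa\in(0,+\infty)$. Then $$\lim_{x\to-\infty}v(x)\ \text{ exists, is finite, and nonpositive.}$$ Also, $$\limsup_{x\to+\infty}|v(x)|=+\infty.$$
   Context: Here $c\in(0,+\infty)$, $\Theta\in\mathbb{R}$, $r_+:=\max\{r,0\}$, $\chi_A$ is the characteristic function of the set $A$, and $K:\mathbb{R}\to[0,+\infty)$ is a nonnegative measurable function. Solutions are classical: $u$ is continuously differentiable in $t$ and twice continuously differentiable in $x$, so that $v\in C^2(\mathbb{R})$, and the equation holds pointwise. *)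

(* Defs.v *)
From HB Require Import structures.
From mathcomp Require Import all_boot all_order all_algebra.
From mathcomp Require Import all_classical all_reals all_analysis.

Set Implicit Arguments.
Unset Strict Implicit.
Unset Printing Implicit Defensive.

Import Order.TTheory GRing.Theory Num.Theory.
Import numFieldNormedType.Exports.

Local Open Scope classical_set_scope.
Local Open Scope ring_scope.

(* The type [R] equipped with the Lebesgue sigma-algebra, whereas the canonical
   instance on [R] is the Borel one; it is the domain of
   [completed_lebesgue_measure]. *)
Definition lebesgueType (R : realType) :=
  caratheodory_type (mu_ext (wlength (@idfun R : cumulative R R))).

Definition lebesgue_measurable_fun (R : realType) (f : R -> R) : Prop :=
  measurable_fun setT (f : lebesgueType R -> R).

Definition positive_part (R : realType) (r : R) : R := Num.max r 0.

Definition C1 (R : realType) (f : R -> R) : Prop :=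
  (forall x, derivable f x 1) /\ continuous f^`()%classic.

Definition C2 (R : realType) (f : R -> R) : Prop :=
  (forall x, derivable f x 1) /\ C1 f^`()%classic.

(* The equation is stated in [\bar R], so that a divergent integral cannot be
   mistaken for a finite value. *)
Definition classical_solution (R : realType) (c Theta : R) (K : R -> R)
    (u : R -> R -> R) : Prop :=
  [/\ forall x, C1 (fun t => u x t),
      forall t, C2 (fun x => u x t) &
      forall x t,
        (((fun s => u x s)^`()%classic t)%:E =
         (c * (fun z => u z t)^`(2)%classic x)%:E +
         \int[@completed_lebesgue_measure R]_y
           (positive_part (u y t - Theta) * K (x - y))%:E)%E].

Definition traveling_wave (R : realType) (omega Theta : R) (v : R -> R)
    (u : R -> R -> R) : Prop :=
  forall x t, u x t = v (x + omega * t) + Theta.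

(* Main.v *)
Require Import Defs.
From HB Require Import structures.
From mathcomp Require Import all_boot all_order all_algebra.
From mathcomp Require Import all_classical all_reals all_analysis.
From mathcomp Require Import lra.

Set Implicit Arguments.
Unset Strict Implicit.

Import Order.TTheory GRing.Theory Num.Theory.
Import numFieldNormedType.Exports.

Local Open Scope classical_set_scope.
Local Open Scope ring_scope.

(** Write [w = v'], [z = v''], [k = omega / c] and let [F s] be the integral of
[v_+ (y + s) K (- y)] over [y]. Evaluating the equation at position [0] and
time [s / omega] gives [omega w - c z = F] on the whole line
([profile_equation]): time translation of the wave provides a form of the
source in which [s] enters only through [v], so that no change of variables in
the integral is required. Since [F >= 0], the function [exp (- k s) w s] is
nonincreasing ([slope_growth_le]).

On the left, [v' 0 > 0] therefore forces [w > 0] on [s <= 0], hence [v <= 0]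
there. Together with the support of [K] this kills the source for
[s <= - rho], so [k v - w] is constant there; as [w >= 0], [v] is bounded below
and monotone, and converges to a nonpositive limit ([profile_cvg_ninfty]).

On the right, [|v|] exceeds any bound arbitrarily far out
([profile_unbounded]), for one of three reasons. If [w] is negative somewhere,
then it stays below that negative value from there on and [v] tends to minus
infinity. Otherwise [v] is nondecreasing, hence so is [F]. If [F] is positive
somewhere, it stays away from [0] afterwards, so that [omega v - c w], a
primitive of [F], grows without bound, and [omega v] dominates it. If [F]
vanishes identically, then [w s = w 0 * exp (k s)], and again [v] is
unbounded. *)

(** * Mean-value estimates and monotone limits *)

Lemma mean_value_ge (R : realType) (f df : R -> R) (d a b : R) :
  (forall x : R, is_derive x 1 f (df x)) -> a <= b ->
  (forall x, a <= x <= b -> d <= df x) -> d * (b - a) <= f b - f a.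
Proof.
move=> f_df ab d_le; have [|t] := MVT_segment ab (fun x _ => f_df x).
  by apply: derivable_within_continuous => x _; case: (f_df x).
rewrite in_itv/= => /d_le le_t ->; apply: ler_wpM2r => //.
by rewrite subr_ge0.
Qed.

Lemma le_of_derivative_ge0 (R : realType) (f df : R -> R) (a b : R) :
  (forall x : R, is_derive x 1 f (df x)) -> a <= b ->
  (forall x, a <= x <= b -> 0 <= df x) -> f a <= f b.
Proof.
by move=> f_df ab df_ge0; have := mean_value_ge f_df ab df_ge0;
  rewrite mul0r subr_ge0.
Qed.

(** Being unbounded is stated with points beyond any [A], which is the form
that a limit superior at infinity consumes. *)
Lemma unbounded_of_derivative_ge (R : realType) (f df : R -> R) (d a : R) :
  (forall x : R, is_derive x 1 f (df x)) -> 0 < d ->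
  (forall x, a <= x -> d <= df x) ->
  forall A M : R, exists2 x, A < x & M < f x.
Proof.
move=> f_df d_gt0 d_le A M.
(* The line of slope [d] through [(a, f a)] exceeds [M] beyond distance
   [`|M - f a| / d] from [a]. *)
pose x := a + (`|M - f a| / d + `|A - a| + 1).
have q_ge0 : 0 <= `|M - f a| / d by rewrite divr_ge0// ltW.
have n1 := ler_norm (M - f a); have n2 := ler_norm (A - a).
have n3 : 0 <= `|A - a| by [].
exists x; first by rewrite /x; lra.
have ax : a <= x by rewrite /x; lra.
have := mean_value_ge f_df ax (fun y ay => d_le y (proj1 (andP ay))).
suff : M - f a < d * (x - a) by lra.
apply: (le_lt_trans n1).
by rewrite mulrC -ltr_pdivrMr// /x; lra.
Qed.

Lemma cvg_ninfty_nondecreasing (R : realType) (f : R -> R) (a m : R) :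
  (forall x y, x <= y -> y <= a -> f x <= f y) ->
  (forall x, x <= a -> m <= f x) ->
  exists2 l : R, f x @[x --> -oo] --> l & l <= f a.
Proof.
move=> f_nd m_le; pose S := [set f x | x in [set x | x <= a]].
have S_inf : has_inf S.
  by split; [exists (f a), a => /=|exists m => _ [x /= xa <-]; exact: m_le].
have inf_le x : x <= a -> inf S <= f x.
  by move=> xa; apply: ge_inf; [case: S_inf|exists x].
exists (inf S); last exact: inf_le.
apply/cvgrPdist_le => e e_gt0.
have [_ [p /= pa <-] f_lt] := inf_adherent e_gt0 S_inf.
near=> x.
have xp : x <= p by near: x; apply: nbhs_ninfty_le; exact: num_real.
have h1 := f_nd x p xp pa; have h2 := inf_le x (le_trans xp pa).
by rewrite ler_norml; apply/andP; split; lra.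
Unshelve. all: by end_near. Qed.

Lemma limf_esup_pinfty_unbounded (R : realType) (f : R -> R) :
  (forall A M, exists2 x, A < x & M < f x) ->
  limf_esup (fun x => (f x)%:E) (pinfty_nbhs R) = +oo%E.
Proof.
move=> unb; apply/eqP; rewrite -leye_eq /limf_esup.
apply: le_ereal_inf_tmp => _ [V [A [_ AV]] <-].
rewrite leye_eq; apply/eqP/eq_infty => M.
have [x /AV Vx Mx] := unb A M.
by apply: ereal_sup_ge; exists (f x)%:E; [exists x|rewrite lee_fin ltW].
Qed.

(** * From the travelling wave to its profile *)

(** The integral of a nonnegative function is the supremum of the integrals of
the simple functions below it, and [g] has more of these than [f]. *)
Lemma nnintegral_le d (T : measurableType d) (R : realType)
    (mu : {measure set T -> \bar R}) (f g : T -> \bar R) :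
  (forall x, 0 <= f x)%E -> (forall x, f x <= g x)%E ->
  (\int[mu]_x f x <= \int[mu]_x g x)%E.
Proof.
move=> f_ge0 fg; rewrite !ge0_integralTE//; last first.
  by move=> x; exact: le_trans (fg x).
apply: le_ereal_sup => _ [h /= hf <-].
by exists h => //= x; exact: le_trans (hf x) (fg x).
Qed.

Lemma derive1_val (R : realType) (f : R -> R) (s df : R) :
  is_derive s 1 f df -> f^`()%classic s = df.
Proof. by rewrite derive1E => f_df; exact: derive_val. Qed.

Lemma is_derive_affine_comp (R : realType) (f : R -> R) (p q e s df : R) :
  is_derive (p * s + q) 1 f df ->
  is_derive s 1 (fun r => f (p * r + q) + e) (p * df).
Proof.
move=> f_df; have aff : is_derive s 1 (fun r => p * r + q) p.
  by apply: is_derive_eq; rewrite scaler1 addr0.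
have comp := @is_derive1_comp _ f (fun r => p * r + q) s _ _ f_df aff.
by apply: is_derive_eq; rewrite addr0 mulrC.
Qed.

(** The equation is used along the line [x = 0] only, at the time [s / omega]
for which the phase [x + omega * t] equals [s]. The kernel then appears as
[K (- y)], which is the same for all [s]. *)
Lemma profile_equation (R : realType) (c Theta omega : R) (K v : R -> R)
    (u : R -> R -> R) :
  0 < omega -> classical_solution c Theta K u ->
  traveling_wave omega Theta v u ->
  [/\ forall s : R, is_derive s 1 v (v^`()%classic s),
      forall s : R, is_derive s 1 v^`()%classic (v^`()%classic^`()%classic s) &
      forall s : R, (omega * v^`()%classic s - c * v^`()%classic^`()%classic s)%:E
        = (\int[@completed_lebesgue_measure R]_y
             (positive_part (v (y + s)) * K (- y))%:E)%E].
Proof.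
move=> omega_gt0 [_ u_C2 u_eq] u_wave.
have u_0 : (fun z => u z 0) = (fun z => v z + Theta).
  by apply/funext => z; rewrite u_wave mulr0 addr0.
have v_u : v = (fun z => u z 0 - Theta).
  by apply/funext => z; rewrite u_wave mulr0 addr0 addrK.
have [u_d [u'_d _]] := u_C2 0.
have v_d s : derivable v s 1.
  by rewrite v_u; apply: derivableB.
have v_is (s : R) : is_derive s 1 v (v^`()%classic s).
  by rewrite derive1E; apply: derivableP.
have dv : v^`()%classic = (fun z => u z 0)^`()%classic.
  apply/funext => z; rewrite u_0 [RHS]derive1E.
  by have vz := v_is z; rewrite derive_val addr0.
have v'_is (s : R) : is_derive s 1 v^`()%classic (v^`()%classic^`()%classic s).
  by rewrite derive1E; apply: derivableP; rewrite dv; exact: u'_d.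
split=> // s; have st : omega * (s / omega) = s by rewrite mulrC divfK// gt_eqF.
have u_t : (fun r => u 0 r) = (fun r => v (omega * r + 0) + Theta).
  by apply/funext => r /=; rewrite u_wave addr0 add0r.
have u_xs : (fun z => u z (s / omega)) = (fun z => v (1 * z + s) + Theta).
  by apply/funext => z; rewrite u_wave st mul1r.
have du_x : (fun z => u z (s / omega))^`()%classic
    = (fun z => v^`()%classic (1 * z + s) + 0).
  apply/funext => z; rewrite u_xs addr0.
  have vz := is_derive_affine_comp Theta (v_is (1 * z + s)).
  by rewrite (derive1_val vz) !mul1r.
have vs : is_derive (omega * (s / omega) + 0) 1 v (v^`()%classic s).
  by rewrite st addr0; exact: v_is.
have vs' : is_derive (1 * 0 + s) 1 v^`()%classic (v^`()%classic^`()%classic s).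
  by rewrite mulr0 add0r; exact: v'_is.
have u_tE : (fun r => u 0 r)^`()%classic (s / omega) = omega * v^`()%classic s.
  by rewrite u_t (derive1_val (is_derive_affine_comp Theta vs)).
have u_xxE : (fun z => u z (s / omega))^`(2)%classic 0
    = v^`()%classic^`()%classic s.
  rewrite -[LHS]/((fun z => u z (s / omega))^`()%classic^`()%classic 0) du_x.
  by rewrite (derive1_val (is_derive_affine_comp 0 vs')) mul1r.
have := u_eq 0 (s / omega); rewrite u_tE u_xxE => E.
rewrite EFinB E addeAC subee// add0e.
by apply: eq_integral => y _; rewrite u_wave st addrK sub0r.
Qed.

(** * Behaviour of the profile at both ends *)

(** The function [w s * exp (- k s)] has derivative
[(z s - k * w s) * exp (- k s) <= 0], so it is nonincreasing. *)
Lemma slope_growth_le (R : realType) (k : R) (w z : R -> R) (x y : R) :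
  (forall s : R, is_derive s 1 w (z s)) ->
  (forall s, z s <= k * w s) ->
  x <= y -> w y <= w x * expR (k * (y - x)).
Proof.
move=> w_z z_le xy.
pose g s := - (w s * expR (- k * s)).
have g_d (s : R) : is_derive s 1 g ((k * w s - z s) * expR (- k * s)).
  have e_d : is_derive s 1 (fun r => expR (- k * r)) (expR (- k * s) * - k).
    apply: (@is_derive1_comp _ expR (fun r => - k * r)).
    by apply: is_derive_eq; rewrite scaler1.
  apply: is_derive_eq => /=.
  by rewrite /GRing.scale/= ; lra.
have g_mono : g x <= g y.
  apply: (le_of_derivative_ge0 g_d xy) => s _.
  by rewrite mulr_ge0 ?expR_ge0// subr_ge0.
rewrite /g lerN2 in g_mono.
rewrite mulrBr expRD -mulNr mulrCA mulrC -ler_pdivrMr ?expR_gt0//.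
by rewrite -expRN -mulNr.
Qed.

(** Where the source [k w - z] is nonpositive, [w - k v] is nondecreasing, so
[k v x >= w x + (k v a - w a) >= k v a - w a] for [x <= a]: the monotone
function [v] is bounded below. *)
Lemma profile_cvg_ninfty (R : realType) (k a : R) (v w z : R -> R) :
  0 < k ->
  (forall s : R, is_derive s 1 v (w s)) ->
  (forall s : R, is_derive s 1 w (z s)) ->
  (forall s, s <= a -> 0 <= w s) ->
  (forall s, s <= a -> k * w s <= z s) ->
  exists2 l : R, v x @[x --> -oo] --> l & l <= v a.
Proof.
move=> k_gt0 v_w w_z w_ge0 kw_le.
have v_nd x y : x <= y -> y <= a -> v x <= v y.
  move=> xy ya; apply: (le_of_derivative_ge0 v_w xy) => s /andP[_ sy].
  by apply: w_ge0; exact: le_trans ya.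
apply: (@cvg_ninfty_nondecreasing _ v a (v a - w a / k) v_nd) => x xa.
have h_d (s : R) : is_derive s 1 (fun r => w r - k * v r) (z s - k * w s).
  exact: is_derive_eq.
have h_mono : w x - k * v x <= w a - k * v a.
  apply: (le_of_derivative_ge0 h_d xa) => s /andP[_ sa].
  by rewrite subr_ge0; exact: kw_le.
have wx := w_ge0 _ xa.
rewrite -(ler_pM2l k_gt0) mulrBr mulrCA divff ?gt_eqF// mulr1.
lra.
Qed.

(** The last hypothesis, monotonicity of the source [k w - z], is asked for
under the assumption [w >= 0] because the source is an average of [v_+], and
inherits its monotonicity from that of [v]. *)
Lemma profile_unbounded (R : realType) (k : R) (v w z : R -> R) :
  0 < k ->
  (forall s : R, is_derive s 1 v (w s)) ->
  (forall s : R, is_derive s 1 w (z s)) ->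
  (forall s, z s <= k * w s) -> 0 < w 0 ->
  ((forall s, 0 <= w s) -> forall x y, x <= y ->
    k * w x - z x <= k * w y - z y) ->
  forall A M, exists2 x, A < x & M < `|v x|.
Proof.
move=> k_gt0 v_w w_z z_le w0_gt0 source_nd A M.
have [w_ge0|/existsNP[x0 /negP]] := pselect (forall s, 0 <= w s); last first.
  (* A negative slope can only get more negative, so [- v] is unbounded. *)
  rewrite -ltNge => wx0_lt0.
  have v_d (s : R) : is_derive s 1 (fun r => - v r) (- w s).
    exact: is_derive_eq.
  have [||x Ax Mx] := @unbounded_of_derivative_ge _ _ _ (- w x0) x0 v_d _ _ A M.
  - by rewrite oppr_gt0.
  - move=> x x0x; rewrite lerN2.
    apply: (le_trans (slope_growth_le w_z z_le x0x)).
    rewrite ler_neMr ?(ltW wx0_lt0)// -expR0 ler_expR.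
    by rewrite mulr_ge0 ?subr_ge0// ltW.
  - by exists x => //; rewrite -normrN; exact: lt_le_trans Mx (ler_norm _).
(* The source is nonnegative and nondecreasing. Once positive, it makes its
   primitive [k v - w] unbounded, and [k v - w <= k v]. *)
have [[x0 x0_gt0]|no_source] := pselect (exists x, 0 < k * w x - z x).
  have h_d (s : R) : is_derive s 1 (fun r => k * v r - w r) (k * w s - z s).
    exact: is_derive_eq.
  have [x Ax Mx] := unbounded_of_derivative_ge h_d x0_gt0
    (fun x x0x => source_nd w_ge0 x0 x x0x) A (k * M).
  exists x => //; apply: lt_le_trans (ler_norm _).
  by rewrite -(ltr_pM2l k_gt0); have := w_ge0 x; lra.
(* With no source at all, [slope_growth_le] applies to [- w] too, and the slope
   grows exponentially from its positive value at [0]. *)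
have kw_le s : k * w s <= z s.
  by rewrite leNgt -subr_gt0; apply/negP => s_gt0; apply: no_source; exists s.
have [x x_ge0|x Ax Mx] := unbounded_of_derivative_ge v_w w0_gt0 (a := 0) _ A M.
  have w_d (s : R) : is_derive s 1 (fun r => - w r) (- z s).
    exact: is_derive_eq.
  have z_le' s : - z s <= k * - w s by rewrite mulrN lerN2.
  have := slope_growth_le w_d z_le' x_ge0; rewrite mulNr lerN2.
  apply: le_trans; rewrite ler_peMr ?(ltW w0_gt0)// -expR0 ler_expR.
  by rewrite mulr_ge0 ?subr_ge0// ltW.
by exists x => //; exact: lt_le_trans Mx (ler_norm _).
Qed.

Theorem theorem2p11 (R : realType) (c Theta omega Lambda rho kappa : R)
    (K v : R -> R) (u : R -> R -> R)
    (c_gt0 : 0 < c) (omega_gt0 : 0 < omega)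
    (Lambda_gt0 : 0 < Lambda) (rho_gt0 : 0 < rho)
    (K_meas : lebesgue_measurable_fun K) (K_ge0 : forall r, 0 <= K r)
    (K_bound : forall r, K r <= Lambda * \1_(`]- rho, rho[%classic) r)
    (u_sol : classical_solution c Theta K u)
    (u_wave : traveling_wave omega Theta v u)
    (v0 : v 0 = 0) (dv0 : v^`()%classic 0 = kappa) (kappa_gt0 : 0 < kappa) :
  (exists2 l : R, v x @[x --> -oo] --> l & l <= 0) /\
  limf_esup (fun x => `|v x|%:E) (pinfty_nbhs R) = +oo%E.
Proof.
have [v_w w_z F_eq] := profile_equation omega_gt0 u_sol u_wave.
move: dv0 v_w w_z F_eq.
set w := v^`()%classic; set z := w^`()%classic => w0 v_w w_z F_eq.
pose k := omega / c; have k_gt0 : 0 < k by exact: divr_gt0.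
have kE s : omega * w s - c * z s = c * (k * w s - z s).
  by rewrite mulrBr mulrA [c * k]mulrC divfK// gt_eqF.
have w0_gt0 : 0 < w 0 by rewrite w0.
have pos_ge0 r : 0 <= positive_part r :> R by rewrite le_max lexx orbT.
have int_ge0 (s y : R) : (0 <= (positive_part (v (y + s)) * K (- y))%:E)%E.
  by rewrite lee_fin mulr_ge0.
have z_le s : z s <= k * w s.
  rewrite -subr_ge0 -(pmulr_rge0 _ c_gt0) -kE -lee_fin F_eq.
  by apply: integral_ge0.
have w_left s : s <= 0 -> 0 <= w s.
  move=> s_le0; have := slope_growth_le w_z z_le s_le0 => /(lt_le_trans w0_gt0).
  by rewrite pmulr_lgt0 ?expR_gt0// => /ltW.
have v_left s : s <= 0 -> v s <= 0.
  move=> s_le0; rewrite -v0.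
  by apply: (le_of_derivative_ge0 v_w s_le0) => y /andP[_ /w_left].
split.
  have [||l v_l l_le] := @profile_cvg_ninfty _ k (- rho) v w z k_gt0 v_w w_z.
  - by move=> s s_le; apply: w_left; lra.
  - move=> s s_le; rewrite -subr_le0 -(pmulr_rle0 _ c_gt0) -kE -lee_fin F_eq.
    rewrite integral0_eq// => y _; congr EFin.
    (* If [y < rho] then [y + s <= 0], where [v <= 0]; otherwise [- y] is
       outside the support of [K]. *)
    have [y_lt|y_ge] := ltP y rho.
      have /max_idPr vy : v (y + s) <= 0 by apply: v_left; lra.
      by rewrite /positive_part vy mul0r.
    suff -> : K (- y) = 0 by rewrite mulr0.
    apply/eqP; rewrite eq_le K_ge0 andbT; apply: (le_trans (K_bound _)).
    rewrite indicE memNset ?mulr0//= in_itv/= => /andP[]; lra.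
  by exists l => //; apply: le_trans l_le _; apply: v_left; lra.
apply: limf_esup_pinfty_unbounded.
apply: (profile_unbounded k_gt0 v_w w_z z_le w0_gt0) => w_ge0 x y xy.
rewrite -(ler_pM2l c_gt0) -!kE -lee_fin !F_eq.
apply: nnintegral_le => // r; rewrite lee_fin ler_wpM2r//.
have v_nd : v (r + x) <= v (r + y).
  have rxy : r + x <= r + y by rewrite lerD2l.
  exact: (le_of_derivative_ge0 v_w rxy).
by rewrite /positive_part ge_max !le_max lexx v_nd orbT.
Qed.
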